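(* For every poset $P$ on $[n]$, $\mathrm{QLB}(P)=n\,(H_n-\mathrm{QH}(P))$.
   Context: A linear extension of $P=([n],\le_P)$ is a permutation $\sigma$ of $[n]$ with $i\le_P j\implies\sigma(i)\le\sigma(j)$; $\Delta(P)$ is the set of linear extensions. For $y\in\mathbb{R}^n$ with $i\le_P j\implies y_i\le y_j$, define $d_i(y)=y_i$ if $i$ is minimal in $P$, and otherwise $d_i(y)=\min\{y_i-y_j: j\ne i,\ j\le_P i\}$; for $\sigma\in\Delta(P)$, $d_i(\sigma):=d_i((\sigma(1),\dots,\sigma(n)))$. $H_q=\sum_{m=1}^q1/m$, $H_0=0$. $\mathrm{QLB}(P)=\mathbb{E}_{\sigma}\left[\sum_{i\in[n]}H_{d_i(\sigma)-1}\right]$ with $\sigma$ uniform on $\Delta(P)$. A chain of $P$ is a set of pairwise comparable elements. The chain polytope is $\mathcal{C}(P)=\{z\in\mathbb{R}^n: z_i\ge0\ \forall i,\ \sum_{i\in C}z_i\le1 \text{ for every chain } C\}$, and $\mathrm{QH}(P)=\mathbb{E}_{z}\left[-\frac1n\sum_{i\in[n]}\ln z_i\right]$ with $z$ uniformly distributed on $\mathcal{C}(P)$. *)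

(* Defs.v *)
From HB Require Import structures.
From mathcomp Require Import all_boot all_order all_algebra all_fingroup.
From mathcomp Require Import all_classical all_reals all_analysis.

Set Implicit Arguments.
Unset Strict Implicit.
Unset Printing Implicit Defensive.

Import Order.TTheory GRing.Theory Num.Theory.
Import numFieldNormedType.Exports.

Local Open Scope classical_set_scope.
Local Open Scope ring_scope.

(* Elements of [n] = {1, ..., n} are encoded by 'I_n = {0, ..., n-1}, and a
   partial order on [n] is a reflexive, antisymmetric and transitive relation
   le on 'I_n; [le j i] stands for j <=_P i. *)

Section Poset.
Variables (n : nat) (le : rel 'I_n).

Definition linear_extensions : {set 'S_n} :=
  [set s : 'S_n | [forall i, forall j, le i j ==> (s i <= s j)%N]].

(* The integer values sigma(i), which range over {1, ..., n}. *)
Definition ext_val (s : 'S_n) (i : 'I_n) : int := (s i).+1%:Z.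

Definition strict_lower (i : 'I_n) : pred 'I_n := [pred j | (j != i) && le j i].

(* The element j0 only serves as the starting value of the iterated minimum,
   and is itself one of the indices over which the minimum is taken. *)
Definition poset_gap (T : realDomainType) (y : 'I_n -> T) (i : 'I_n) : T :=
  if [pick j in strict_lower i] is Some j0
  then \big[Num.min/y i - y j0]_(j in strict_lower i) (y i - y j)
  else y i.

Definition is_chain (C : {set 'I_n}) : bool :=
  [forall i in C, forall j in C, le i j || le j i].

End Poset.

Definition harmonic_number (R : realType) (q : nat) : R :=
  \sum_(1 <= m < q.+1) m%:R^-1.

(* Gaps of linear extensions are integers >= 1, so the absolute value is only
   a conversion from int to nat. *)
Definition QLB (R : realType) n (le : rel 'I_n) : R :=
  (\sum_(s in linear_extensions le) \sum_(i < n)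
     harmonic_number R `|poset_gap le (ext_val s) i - 1|%N)
  / #|linear_extensions le|%:R.

(* Lebesgue measure on R^n, built by iterating the binary product measure. *)

Section TupleCons.
Variables (R : realType) (n : nat).
Local Notation T := (measurableTypeR R).

Definition tuple_cons (p : T * n.-tuple T) : n.+1.-tuple T :=
  [tuple of p.1 :: p.2].

Lemma measurable_tuple_cons : measurable_fun [set: T * n.-tuple T] tuple_cons.
Proof. exact: measurable_cons. Qed.

Definition tuple_uncons (z : n.+1.-tuple T) : T * n.-tuple T :=
  (thead z, [tuple of behead z]).

Lemma measurable_tuple_uncons : measurable_fun [set: n.+1.-tuple T] tuple_uncons.
Proof.
apply/measurable_fun_pair; last exact: measurable_behead.
exact: (@measurable_tnth _ T n.+1 ord0).
Qed.

Lemma tuple_consK : cancel tuple_cons tuple_uncons.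
Proof.
move=> [x y]; rewrite /tuple_uncons /tuple_cons /= theadE.
by congr pair; exact/val_inj.
Qed.

Variable mu : {sigma_finite_measure set (n.-tuple T) -> \bar R}.

Definition lebesgue_cons : set (n.+1.-tuple T) -> \bar R :=
  pushforward (@lebesgue_measure R \x mu)%E tuple_cons.

Let nu : {measure set (n.+1.-tuple T) -> \bar R} :=
  measure_function_pushforward__canonical__measure_function_Measure
    (@lebesgue_measure R \x mu)%E measurable_tuple_cons.

Let lebesgue_cons0 : lebesgue_cons set0 = 0%E.
Proof. exact: (measure0 nu). Qed.

Let lebesgue_cons_ge0 A : (0 <= lebesgue_cons A)%E.
Proof. exact: (measure_ge0 nu). Qed.

Let lebesgue_cons_sigma_additive : semi_sigma_additive lebesgue_cons.
Proof. exact: (@measure_semi_sigma_additive _ _ _ nu). Qed.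

HB.instance Definition _ := isMeasure.Build _ _ _ lebesgue_cons
  lebesgue_cons0 lebesgue_cons_ge0 lebesgue_cons_sigma_additive.

Lemma lebesgue_consE (B : set T) (C : set (n.-tuple T)) :
  measurable B -> measurable C ->
  lebesgue_cons (tuple_uncons @^-1` (B `*` C)) =
  (lebesgue_measure B * mu C)%E.
Proof.
move=> mB mC; rewrite -product_measure1E// /lebesgue_cons /pushforward.
by rewrite -comp_preimage (_ : _ \o _ = id)//; exact/funext/tuple_consK.
Qed.

Let lebesgue_cons_sigma_finite : sigma_finite [set: n.+1.-tuple T] lebesgue_cons.
Proof.
have /sigma_finiteP[F [UF ndF mF]] := sigma_finiteT (@lebesgue_measure R).
have /sigma_finiteP[G [UG ndG mG]] := sigma_finiteT mu.
exists (fun k => tuple_uncons @^-1` (F k `*` G k)).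
  rewrite -preimage_bigcup -[LHS](preimage_setT tuple_uncons).
  congr (_ @^-1` _); rewrite -setXTT UF UG; apply/seteqP; split=> -[x y] /=.
    move=> [[i _ Fx] [j _ Gy]]; exists (maxn i j) => //; split.
      by move: x Fx; exact/subsetPset/ndF/leq_maxl.
    by move: y Gy; exact/subsetPset/ndG/leq_maxr.
  by move=> [i _ [Fx Gy]]; split; exists i.
move=> k; have [mFk Fk_fin] := mF k; have [mGk Gk_fin] := mG k; split.
  rewrite -[X in measurable X]setTI.
  by apply: measurable_tuple_uncons => //; exact: measurableX.
by rewrite lebesgue_consE// lte_mul_pinfty// ge0_fin_numE.
Qed.

HB.instance Definition _ := Measure_isSigmaFinite.Build _ _ _ lebesgue_cons
  lebesgue_cons_sigma_finite.

End TupleCons.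

Fixpoint tuple_lebesgue (R : realType) (n : nat) :
    {sigma_finite_measure set (n.-tuple (measurableTypeR R)) -> \bar R} :=
  if n is m.+1 then lebesgue_cons (tuple_lebesgue R m) else \d_[tuple].

Section ChainPolytope.
Variables (R : realType) (n : nat) (le : rel 'I_n).
Local Notation T := (measurableTypeR R).
Local Notation volume := (tuple_lebesgue R n).

Definition chain_polytope : set (n.-tuple T) :=
  [set z | (forall i, 0 <= tnth z i :> R) /\
    forall C : {set 'I_n}, is_chain le C -> \sum_(i in C) (tnth z i : R) <= 1].

Lemma measurable_chain_polytope : measurable chain_polytope.
Proof.
have mcoord (i : 'I_n) :
    measurable_fun setT (fun z : n.-tuple T => tnth z i : T).
  exact: measurable_tnth.
have -> : chain_polytope =
    (\bigcap_(i in [set: 'I_n]) ((fun z => tnth z i) @^-1` `[0, +oo[)) `&`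
    (\bigcap_(C in [set C : {set 'I_n} | is_chain le C])
       ((fun z => \sum_(i in C) (tnth z i : R)) @^-1` `]-oo, 1])).
  apply/seteqP; split => z /=.
    move=> [z0 z1]; split.
      by move=> i _ /=; rewrite in_itv/= andbT; exact: z0.
    by move=> C cC /=; rewrite in_itv/=; exact: z1.
  move=> [z0 z1]; split.
    by move=> i; have := z0 i Logic.I; rewrite /= in_itv/= andbT.
  by move=> C cC; have := z1 C cC; rewrite /= in_itv/=.
apply: measurableI; apply: fin_bigcap_measurable; try exact: finite_finset.
  by move=> i _; rewrite -[X in measurable X]setTI; exact: mcoord.
move=> C _; rewrite -[X in measurable X]setTI.
suff mS : measurable_fun setT
    (fun z : n.-tuple T => \sum_(i in C) (tnth z i : R)) by exact: mS.
rewrite (_ : (fun _ => _) =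
    fun z : n.-tuple T => \sum_(i < n) (if i \in C then tnth z i : R else 0)); last first.
  by apply/funext => z; rewrite big_mkcond.
apply: (@measurable_sum _ _ R _ _ _
  (fun i (z : n.-tuple T) => if i \in C then tnth z i : R else 0)) => i.
by case: (i \in C) => //; exact: mcoord.
Qed.

Definition chain_polytope_measure : set (n.-tuple T) -> \bar R :=
  mrestr volume measurable_chain_polytope.

HB.instance Definition _ := Measure.on chain_polytope_measure.

(* The second argument of mnormalize is only used for measures of total mass 0
   or +oo; see uniform_chain_polytopeE below. *)
Definition uniform_chain_polytope : probability (n.-tuple T) R :=
  mnormalize chain_polytope_measure (dirac point).

(* The library's convention for ln at 0 is immaterial: the points of the
   polytope with a vanishing coordinate have measure 0. The expectation is
   extended-real-valued, so a finite value of QH is a meaningful assertion. *)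
Definition QH : \bar R :=
  ('E_uniform_chain_polytope
     [(fun z => - n%:R^-1 * \sum_(i < n) ln (tnth z i : R))%R])%E.

End ChainPolytope.

Arguments chain_polytope R {n} le.
Arguments uniform_chain_polytope R {n} le.
Arguments QH R {n} le.

Section Volume.
Variable R : realType.
Local Notation T := (measurableTypeR R).

Lemma measurable_tuple_box n (A : 'I_n -> set T) :
  (forall i, measurable (A i)) ->
  measurable [set z : n.-tuple T | forall i, A i (tnth z i)].
Proof.
move=> mA.
rewrite (_ : [set z | _] =
    \bigcap_(i in [set: 'I_n]) ((fun z : n.-tuple T => tnth z i) @^-1` A i)).
  apply: fin_bigcap_measurable; first exact: finite_finset.
  by move=> i _; rewrite -[X in measurable X]setTI; exact: measurable_tnth.
by apply/seteqP; split=> z /= Az i; [move=> _|]; exact: Az.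
Qed.

Lemma tuple_lebesgue_box n (A : 'I_n -> set T) :
  (forall i, measurable (A i)) ->
  tuple_lebesgue R n [set z | forall i, A i (tnth z i)] =
  (\prod_(i < n) lebesgue_measure (A i))%E.
Proof.
elim: n A => [|n IH] A mA /=.
  rewrite big_ord0 /dirac indicE mem_set//= => -[].
  by case.
have tnthSE (z : n.+1.-tuple T) i :
    tnth z (lift ord0 i) = tnth [tuple of behead z] i.
  by rewrite {1}(tuple_eta z) tnthS.
rewrite big_ord_recl -IH; last by move=> i; exact: mA.
rewrite -lebesgue_consE//; last first.
  by apply: (measurable_tuple_box (A := fun i => A (lift ord0 i))).
congr (lebesgue_cons _ _); apply/seteqP; split=> z /=.
  by move=> Az; split=> [|i]; [|rewrite -tnthSE]; exact: Az.
move=> [A0 Az] i; case: (unliftP ord0 i) => [j ->|->//].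
by rewrite tnthSE; exact: Az.
Qed.

Lemma chain_polytope_volume_gt0 n (le : rel 'I_n) :
  (0 < tuple_lebesgue R n (chain_polytope R le))%E.
Proof.
pose a : R := n.+1%:R^-1.
have a0 : 0 < a by rewrite invr_gt0 ltr0n.
pose I (i : 'I_n) : set T := `[0, a]%classic : set R.
have mI i : measurable (I i) by exact: measurable_itv.
pose B := [set z : n.-tuple T | forall i, I i (tnth z i)].
have mB : measurable B by exact: measurable_tuple_box.
apply: (@lt_le_trans _ _ (tuple_lebesgue R n B)).
  rewrite (tuple_lebesgue_box mI).
  elim/big_ind: _ => // [x y|i _]; first exact: mule_gt0.
  by rewrite lebesgue_measure_itv/= lte_fin a0 oppr0 adde0 lte_fin.
apply: le_measure; rewrite ?inE//; first exact: measurable_chain_polytope.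
move=> z Bz; split=> [i|C _].
  by have := Bz i; rewrite /I /= in_itv/= => /andP[].
apply: (@le_trans _ _ (\sum_(i in C) a)).
  by apply: ler_sum => i _; have := Bz i; rewrite /I /= in_itv/= => /andP[].
rewrite sumr_const -[_ *+ _]mulr_natr /a mulrC ler_pdivrMr ?ltr0n// mul1r ler_nat.
by rewrite (leq_trans (max_card _))// card_ord.
Qed.

Lemma chain_polytope_volume_lty n (le : rel 'I_n) : reflexive le ->
  (tuple_lebesgue R n (chain_polytope R le) < +oo)%E.
Proof.
move=> lexx.
pose I (i : 'I_n) : set T := `[0, 1]%classic : set R.
have mI i : measurable (I i) by exact: measurable_itv.
pose B := [set z : n.-tuple T | forall i, I i (tnth z i)].
have mB : measurable B by exact: measurable_tuple_box.
apply: (@le_lt_trans _ _ (tuple_lebesgue R n B)).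
  apply: le_measure; rewrite ?inE//; first exact: measurable_chain_polytope.
  move=> z [z0 z1] i; rewrite /I /= in_itv/= z0/=.
  have := z1 [set i]%SET; rewrite big_set1; apply.
  by apply/forall_inP => j /set1P ->; apply/forall_inP => k /set1P ->; rewrite lexx.
rewrite (tuple_lebesgue_box mI).
rewrite (eq_bigr (fun=> 1%E)); last first.
  by move=> i _; rewrite lebesgue_measure_itv/= lte_fin ltr01 oppr0 adde0.
by rewrite big1// ltry.
Qed.

Lemma uniform_chain_polytopeE n (le : rel 'I_n) (A : set (n.-tuple T)) :
  reflexive le ->
  uniform_chain_polytope R le A =
  (tuple_lebesgue R n (A `&` chain_polytope R le) *
   (fine (tuple_lebesgue R n (chain_polytope R le)))^-1%:E)%E.
Proof.
move=> lexx; rewrite /uniform_chain_polytope/= /mnormalize/=.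
rewrite /chain_polytope_measure /mrestr setTI ifF//.
by rewrite gt_eqF ?chain_polytope_volume_gt0//= lt_eqF// chain_polytope_volume_lty.
Qed.

End Volume.

(* Main.v *)
Require Import Defs.
From mathcomp Require Import all_boot all_order all_algebra all_fingroup.
From mathcomp Require Import all_classical all_reals all_analysis.
From mathcomp Require Import measurable_realfun.
From mathcomp Require Import ring zify.

(* Idea. Stanley's transfer map y |-> (y_i - max(0, max_{j < i} y_j))_i is a
   composition of coordinate shifts, hence preserves Lebesgue measure, and it
   pulls the chain polytope back to the order polytope. Up to ties, the order
   polytope is the disjoint union, over the linear extensions sigma, of copies
   of the simplex 0 <= y_1 <= ... <= y_n <= 1, and on the copy indexed by sigma
   the i-th transferred coordinate is a sum of d_i(sigma) consecutive spacings.
   The spacings of that simplex are exchangeable, being the transfer of the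
   chain poset, so this sum may be replaced by y_d with d = d_i(sigma), and the
   mean of -ln y_d is 1/d + ... + 1/n = H_n - H_{d-1} by peeling off the largest
   coordinates one at a time. *)

Set Implicit Arguments.
Unset Strict Implicit.
Unset Printing Implicit Defensive.

Import Order.TTheory GRing.Theory Num.Theory.
Import numFieldNormedType.Exports.

Local Open Scope classical_set_scope.
Local Open Scope ring_scope.

(** * Maps preserving Lebesgue measure *)

Section Preserving.
Variable R : realType.
Local Notation T := (measurableTypeR R).
Local Notation vol n := (tuple_lebesgue R n).

Definition lebesgue_preserving n (f : n.-tuple T -> n.-tuple T) : Prop :=
  measurable_fun [set: n.-tuple T] f /\
  forall A, measurable A -> vol n (f @^-1` A) = vol n A.

Lemma lebesgue_preserving_id n : lebesgue_preserving (@id (n.-tuple T)).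
Proof. by split. Qed.

Lemma lebesgue_preserving_comp n (f g : n.-tuple T -> n.-tuple T) :
  lebesgue_preserving f -> lebesgue_preserving g ->
  lebesgue_preserving (f \o g).
Proof.
move=> [mf pf] [mg pg]; split; first exact: measurableT_comp.
move=> A mA; rewrite comp_preimage pg ?pf//.
by rewrite -[X in measurable X]setTI; exact: mf.
Qed.

Lemma integral_preserving n (f : n.-tuple T -> n.-tuple T)
    (D : set (n.-tuple T)) (F : n.-tuple T -> \bar R) :
  lebesgue_preserving f -> measurable D -> measurable_fun D F ->
  (forall y, D y -> (0 <= F y)%E) ->
  (\int[vol n]_(y in D) F y = \int[vol n]_(y in f @^-1` D) F (f y))%E.
Proof.
move=> [mf pf] mD mF F0.
rewrite -(ge0_integral_pushforward mf)//; last by move=> y /set_mem; exact: F0.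
apply: (@eq_measure_integral _ _ _ _
  (measure_function_pushforward__canonical__measure_function_Measure
     (vol n) mf)) => A mA _.
by rewrite /= /pushforward pf.
Qed.

(** Lebesgue measure is determined by its values on the intervals []a, b]], whose translates have
    the same length. *)
Lemma lebesgue_measure_translation (c : R) (A : set T) : measurable A ->
  lebesgue_measure ((fun x : T => x + c : T) @^-1` A) = lebesgue_measure A.
Proof.
move=> mA; have mt : measurable_fun [set: T] (fun x : T => x + c : T).
  exact: measurable_funD.
apply/esym.
apply: (@lebesgue_measure_unique R
  (measure_function_pushforward__canonical__measure_function_Measure
     (@lebesgue_measure R) mt)) => // X [[a b] _ <-] /=.
rewrite /pushforward (_ : _ @^-1` _ = `]a - c, b - c]%classic); last first.
  by apply/seteqP; split => x /=; rewrite !in_itv/= ltrBlDr lerBrDr.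
rewrite !lebesgue_measure_itv/= !lte_fin ltrD2r.
by case: ifP => // _; rewrite -!EFinB opprB addrA subrK.
Qed.

(* [h] will be independent of the coordinate [i], which makes the shift a
   translation on each line parallel to the [i]-th axis. *)
Definition tuple_shift n (i : 'I_n) (h : n.-tuple T -> R) (y : n.-tuple T) :
    n.-tuple T :=
  [tuple (if j == i then tnth y j + h y else tnth y j) | j < n].

Lemma measurable_tuple_shift n (i : 'I_n) (h : n.-tuple T -> R) :
  measurable_fun [set: n.-tuple T] h ->
  measurable_fun [set: n.-tuple T] (tuple_shift i h).
Proof.
move=> mh; apply/measurable_fun_tnthP => j.
rewrite (_ : _ \o _ =
    fun y => if j == i then tnth y j + h y else tnth y j); last first.
  by apply/funext => y /=; rewrite tnth_mktuple.
case: eqP => _; last exact: measurable_tnth.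
by apply: measurable_funD => //; exact: measurable_tnth.
Qed.

(** Induction on the dimension by slicing. If [i] is the head, each line parallel to the head axis
    is translated by a constant. Otherwise, with the head fixed, the map is a shift of the same kind
    on the tail. *)
Lemma tuple_shift_preserving n (i : 'I_n) (h : n.-tuple T -> R) :
  measurable_fun [set: n.-tuple T] h ->
  (forall y y', (forall j, j != i -> tnth y j = tnth y' j) -> h y = h y') ->
  lebesgue_preserving (tuple_shift i h).
Proof.
move=> mh ih; split; first exact: measurable_tuple_shift.
elim: n i h mh ih => [[]//|n IH] i h mh ih A mA.
have mB : measurable (tuple_shift i h @^-1` A).
  by rewrite -[X in measurable X]setTI; exact: measurable_tuple_shift.
have mcons (B : set (n.+1.-tuple T)) : measurable B ->
    measurable (@tuple_cons R n @^-1` B).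
  by move=> mB'; rewrite -[X in measurable X]setTI; exact: measurable_tuple_cons.
rewrite /= /lebesgue_cons /pushforward.
case: (unliftP ord0 i) => [j ij|i0]; last first.
  (* The volume is built by slicing at a fixed head; here the tail must be fixed instead, so the
     other iterated integral is used. *)
  have swap B : measurable B ->
      (@lebesgue_measure R \x vol n)%E B = (@lebesgue_measure R \x^ vol n)%E B.
    by apply: product_measure_unique => X Y mX mY; exact: product_measure2E.
  rewrite !swap; [|exact: mcons|exact: mcons].
  apply: eq_integral => y _ /=.
  (* [h] ignores the head, so its constant value on the line over [y] is read off with 0 in that
     place. *)
  rewrite -[RHS](@lebesgue_measure_translation (h [tuple of 0 :: y])); last first.
    by apply: measurable_ysection; exact: mcons.
  have shiftE (x : T) : tuple_shift i h (tuple_cons (x, y)) =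
      tuple_cons (x + h [tuple of 0 :: y] : T, y).
    apply: eq_from_tnth => k; rewrite tnth_mktuple i0.
    case: (unliftP ord0 k) => [m ->|->]; first by rewrite !tnthS.
    rewrite eqxx !(tnth0 (_ : T)); congr (_ + _); apply: ih => l; rewrite i0.
    by case: (unliftP ord0 l) => [m ->|->]; rewrite ?eqxx// !tnthS.
  by congr lebesgue_measure; apply/seteqP; split=> x /=;
    rewrite /ysection/= !inE/= shiftE.
apply: eq_integral => x _ /=.
pose hx (y : n.-tuple T) := h (tuple_cons (x : T, y)).
rewrite -[RHS](IH j hx); last 3 first.
- apply: (measurableT_comp mh); apply: measurableT_comp.
    exact: measurable_tuple_cons.
  exact: pair1_measurable.
- move=> y y' yy'; apply: ih => k ki.
  case: (unliftP ord0 k) ki => [m ->|->]; last by rewrite !tnth0.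
  by rewrite ij (inj_eq lift_inj) !tnthS; exact: yy'.
- by apply: measurable_xsection; exact: mcons.
have shiftE y : tuple_shift i h (tuple_cons (x : T, y)) =
    tuple_cons (x : T, tuple_shift j hx y).
  apply: eq_from_tnth => k; rewrite tnth_mktuple.
  case: (unliftP ord0 k) => [m ->|->]; last by rewrite !tnth0 ij.
  by rewrite !tnthS tnth_mktuple ij (inj_eq lift_inj).
by congr (vol n _); apply/seteqP; split=> y /=;
  rewrite /xsection/= !inE/= shiftE.
Qed.

End Preserving.

(** * Coordinate permutations and diagonals *)

Section Permutation.
Variable R : realType.
Local Notation T := (measurableTypeR R).
Local Notation vol n := (tuple_lebesgue R n).

Definition tuple_perm n (s : 'S_n) (y : n.-tuple T) : n.-tuple T :=
  [tuple tnth y (s i) | i < n].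

Definition measurable_boxes n : set (set (n.-tuple T)) :=
  [set B | exists2 A : 'I_n -> set T, (forall i, measurable (A i)) &
     B = [set z | forall i, A i (tnth z i)]].

(** The preimage of [A] under the coordinate [i] is the box with side [A] at [i] and full sides
    elsewhere, so boxes generate the sigma-algebra of tuples. *)
Lemma measurable_tupleE n :
  @measurable _ (n.-tuple T) = <<s @measurable_boxes n >>.
Proof.
apply/seteqP; split; last first.
  apply: smallest_sub; first exact: sigma_algebra_measurable.
  by move=> _ [A mA ->]; exact: measurable_tuple_box.
have mid : measurable_fun setT
    (id : g_sigma_algebraType (@measurable_boxes n) -> n.-tuple T).
  apply/measurable_fun_tnthP => i _ A mA; rewrite setTI.
  apply: sub_sigma_algebra; exists (fun j => if j == i then A else setT).
    by move=> j; case: eqP.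
  apply/seteqP; split => z /=; first by move=> Az j; case: eqP => // ->.
  by move=> /(_ i); rewrite eqxx.
by move=> A mA; have := mid measurableT A mA; rewrite setTI.
Qed.

Lemma measurable_boxes_setI n : setI_closed (@measurable_boxes n).
Proof.
move=> _ _ [A mA ->] [B mB ->]; exists (fun i => A i `&` B i).
  by move=> i; exact: measurableI.
apply/seteqP; split => z /=; first by move=> [Az Bz] i; split.
by move=> ABz; split=> i; have [] := ABz i.
Qed.

(** Boxes form a generating class closed under intersection, and permuting the sides of a box only
    permutes the factors of its volume. The cubes [cube k] exhaust the space with finite volume, so
    agreement on boxes suffices. *)
Lemma tuple_perm_preserving n (s : 'S_n) : lebesgue_preserving (tuple_perm s).
Proof.
have ms : measurable_fun [set: n.-tuple T] (tuple_perm s).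
  apply/measurable_fun_tnthP => i.
  rewrite (_ : _ \o _ = fun y => tnth y (s i)); first exact: measurable_tnth.
  by apply/funext => y /=; rewrite tnth_mktuple.
split=> // A mA.
pose cube (k : nat) : set (n.-tuple T) :=
  [set z | forall i, (`[- k%:R, k%:R]%classic : set R) (tnth z i)].
have mitv (k : nat) : measurable (`[- k%:R, k%:R]%classic : set T).
  exact: measurable_itv.
apply: (measure_unique (@measurable_boxes n) cube _ _ _ _
  (measure_function_pushforward__canonical__measure_function_Measure
     (vol n) ms)) => //.
- exact: measurable_tupleE.
- exact: measurable_boxes_setI.
- by move=> k; exists (fun=> `[- k%:R, k%:R]%classic).
- apply/seteqP; split=> // z _.
  pose M := \sum_(i < n) `|tnth z i : R|.
  exists (Num.Def.archi_bound M) => // i; rewrite /= in_itv/= -ler_norml.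
  have M0 : 0 <= M by exact: sumr_ge0.
  apply: (le_trans _ (ltW (archi_boundP M0))).
  by rewrite /M (bigD1 i)//= lerDl sumr_ge0.
- move=> _ [B mB ->]; rewrite /= /pushforward.
  rewrite (_ : _ @^-1` _ =
      [set z | forall i, B ((s^-1)%g i) (tnth z i)]); last first.
    apply/seteqP; split => z /= Bz i.
      by have := Bz ((s^-1)%g i); rewrite tnth_mktuple permKV.
    by have := Bz (s i); rewrite tnth_mktuple permK.
  rewrite (tuple_lebesgue_box (A := fun i => B ((s^-1)%g i)))//.
  rewrite tuple_lebesgue_box// (reindex_inj (@perm_inj _ s))/=.
  by apply: eq_bigr => i _; rewrite permK.
- move=> k; rewrite /= /pushforward.
  rewrite (_ : _ @^-1` _ = cube k); last first.
    apply/seteqP; split => z /= zk i.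
      by have := zk ((s^-1)%g i); rewrite tnth_mktuple permKV.
    by rewrite tnth_mktuple.
  rewrite (tuple_lebesgue_box (fun=> mitv k)).
  suff : (\prod_(i < n) @lebesgue_measure R (`[- k%:R, k%:R]%classic)%R)%E \is a fin_num.
    by move=> /fin_numPlt/andP[].
  elim/big_ind: _ => // [x y|i _]; first exact: fin_numM.
  by rewrite lebesgue_measure_itv/=; case: ifP.
Qed.

(* A shear carries the diagonal to the hyperplane [y_i = 0]. *)
Lemma tuple_lebesgue_eq_coord n (i j : 'I_n) : i != j ->
  vol n [set y | tnth y i = tnth y j] = 0%E.
Proof.
move=> ij.
have mh : measurable_fun [set: n.-tuple T] (fun y => - tnth y j : R).
  apply: measurableT_comp => //; exact: measurable_tnth.
have [_ sp] : lebesgue_preserving (tuple_shift i (fun y => - tnth y j : R)).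
  by apply: tuple_shift_preserving => // y y' yy'; rewrite yy'// eq_sym.
pose A k : set T := if k == i then [set 0 : R] else setT.
have mA k : measurable (A k) by rewrite /A; case: eqP.
have := sp _ (measurable_tuple_box mA).
have Ai : A i = [set 0] by rewrite /A eqxx.
rewrite (tuple_lebesgue_box mA) (bigD1 i)//= Ai lebesgue_measure_set1 mul0e => <-; congr (vol n _).
apply/seteqP; split => y /=.
  by move=> yij k; rewrite /A tnth_mktuple; case: eqP => //= ->; rewrite yij subrr.
by move=> /(_ i); rewrite /A tnth_mktuple eqxx /= => /subr0_eq.
Qed.

End Permutation.

(** * The transfer map *)

Section Transfer.
Variables (R : realType) (n : nat) (le : rel 'I_n).
Local Notation T := (measurableTypeR R).
Implicit Types (y : n.-tuple T) (i j : 'I_n).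

(** Starting the maximum at 0 makes the transfer map fix the coordinates of minimal elements. *)
Definition lower_max i y : R :=
  \big[Num.max/0]_(j in strict_lower le i) (tnth y j : R).

(** A partial transfer, which lets the coordinates be treated one at a time by induction on [S]. *)
Definition transfer_on (S : {set 'I_n}) y : n.-tuple T :=
  [tuple (if i \in S then (tnth y i : R) - lower_max i y else tnth y i) | i < n].

Definition transfer y : n.-tuple T :=
  [tuple (tnth y i : R) - lower_max i y | i < n].

Definition order_polytope : set (n.-tuple T) :=
  [set y | (forall i, 0 <= (tnth y i : R) <= 1) /\
    forall i j, le i j -> (tnth y i : R) <= tnth y j].

Lemma in_strict_lower i j : (j \in strict_lower le i) = (j != i) && le j i.
Proof. by []. Qed.

Lemma lower_max_ge0 i y : 0 <= lower_max i y.
Proof. exact: bigmax_ge_id. Qed.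

Lemma le_lower_max i j y : j \in strict_lower le i -> (tnth y j : R) <= lower_max i y.
Proof. by move=> ij; rewrite /lower_max; apply: le_bigmax_cond. Qed.

Lemma lower_max_le i y b : 0 <= b ->
  (forall j, j \in strict_lower le i -> (tnth y j : R) <= b) -> lower_max i y <= b.
Proof. by move=> b0 yb; apply: bigmax_le. Qed.

Lemma lower_max_attained i y : lower_max i y = 0 \/
  exists2 j, j \in strict_lower le i & lower_max i y = tnth y j.
Proof.
rewrite /lower_max; elim: index_enum => [|j r IH].
  by left; rewrite big_nil.
rewrite big_cons; case: ifP => // ij.
by rewrite maxEle; case: ifP => // _; right; exists j.
Qed.

Lemma measurable_lower_max i : measurable_fun [set: n.-tuple T] (lower_max i).
Proof.
rewrite /lower_max; elim: (index_enum _) => [|j r IH].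
  rewrite (_ : (fun _ => _) = cst 0); first exact: measurable_cst.
  by apply/funext => y; rewrite big_nil.
have [ij|ij] := boolP (j \in strict_lower le i); last first.
  rewrite (_ : (fun _ => _) = fun y : n.-tuple T =>
    \big[Num.max/0]_(j <- r | j \in strict_lower le i) (tnth y j : R))//.
  by apply/funext => y; rewrite big_cons (negPf ij).
rewrite (_ : (fun _ => _) = (fun y : n.-tuple T => tnth y j : R) \max
  (fun y : n.-tuple T =>
    \big[Num.max/0]_(j <- r | j \in strict_lower le i) (tnth y j : R))).
  by apply: measurable_maxr => //; exact: measurable_tnth.
by apply/funext => y; rewrite big_cons ij.
Qed.

Hypotheses (le_ref : reflexive le) (le_asym : antisymmetric le)
  (le_tr : transitive le).

(** Any strictly increasing function would do: it selects minimal elements of a set, top elements of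
    a chain, and serves as an induction measure. *)
Definition height i := #|[set j | le j i]%SET|.

Lemma height_strict i j : j \in strict_lower le i -> (height j < height i)%N.
Proof.
rewrite in_strict_lower => /andP[ji leji]; apply/proper_card/properP; split.
  by apply/fintype.subsetP => k; rewrite !inE => /le_tr; exact.
exists i; rewrite !inE ?le_ref//; apply: contra ji => leij.
by apply/eqP/le_asym; rewrite leji leij.
Qed.

(* Peeling a minimal element [i] off an up-closed [S] leaves the coordinates
   strictly below [i] untouched, so that the shift of [i] can be applied last. *)
Lemma transfer_on_preserving (S : {set 'I_n}) :
  (forall i j, i \in S -> le i j -> j \in S) ->
  lebesgue_preserving (transfer_on S).
Proof.
have [m] := ubnP #|S|; elim: m S => // m IH S; rewrite ltnS => Sm upS.
have [->|[i0 i0S]] := set_0Vmem S.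
  rewrite (_ : transfer_on _ = id); first exact: lebesgue_preserving_id.
  apply/funext => y; apply: eq_from_tnth => i.
  by rewrite tnth_mktuple inE.
case: (arg_minnP height i0S) => i /= iS imin.
have {}iS : i \in S := iS.
have lowS j : j \in strict_lower le i -> j \notin S.
  by move=> /height_strict; rewrite ltnNge; apply: contra => /imin.
rewrite (_ : transfer_on S =
    tuple_shift i (fun y => - lower_max i y) \o transfer_on (S :\ i)%SET); last first.
  apply/funext => y; apply: eq_from_tnth => k; rewrite /= !tnth_mktuple !inE.
  case: eqP => [->|_] //=; rewrite iS; congr (_ - _).
  apply: eq_bigr => j ij; rewrite tnth_mktuple !inE.
  by rewrite (negPf (lowS _ ij)) andbF.
apply: lebesgue_preserving_comp.
  apply: tuple_shift_preserving.
    by apply: measurableT_comp => //; exact: measurable_lower_max.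
  move=> y y' yy'; congr (- _); apply: eq_bigr => j.
  by rewrite in_strict_lower => /andP[/yy'].
apply: IH; first by rewrite (leq_trans _ Sm)// [X in (_ < X)%N](cardsD1 i) iS.
move=> j k; rewrite !inE => /andP[ji jS] jk; rewrite (upS j)// andbT.
apply/eqP => ki; have := lowS j.
by rewrite in_strict_lower ji -[in le j i]ki jk jS => /(_ isT).
Qed.

Lemma transfer_preserving : lebesgue_preserving transfer.
Proof.
rewrite (_ : transfer = transfer_on [set: 'I_n]%SET).
  by apply: transfer_on_preserving => *; rewrite inE.
by apply/funext => y; apply: eq_from_tnth => i; rewrite !tnth_mktuple inE.
Qed.

(** Remove the top [t] of the chain. The rest lies strictly below [t], so by induction with the
    bound [lower_max t y] its sum is at most what the transfer subtracts at [t]. The total is then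
    at most the coordinate of [y] at [t]. The free bound [b] is what makes this induction go
    through. *)
Lemma chain_sum_transfer_le y (C : {set 'I_n}) (b : R) :
  order_polytope y -> is_chain le C -> 0 <= b ->
  (forall i, i \in C -> (tnth y i : R) <= b) ->
  \sum_(i in C) (tnth (transfer y) i : R) <= b.
Proof.
move=> [y01 yle]; have [m] := ubnP #|C|.
elim: m C b => // m IH C b; rewrite ltnS => Cm chC b0 yb.
have [->|[i0 i0C]] := set_0Vmem C; first by rewrite big_set0.
case: (arg_maxnP height i0C) => t /= tC tmax.
have {}tC : t \in C := tC.
have Ct j : j \in (C :\ t)%SET -> j \in strict_lower le t.
  move=> /setD1P[jt jC]; rewrite in_strict_lower jt /=.
  have /orP[//|tj] := forall_inP (forall_inP chC j jC) t tC.
  have := height_strict (i := j) (j := t).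
  rewrite in_strict_lower eq_sym jt tj => /(_ isT).
  by rewrite ltnNge (tmax j jC).
rewrite (big_setD1 t)//= tnth_mktuple.
apply: (@le_trans _ _ (tnth y t : R)); last exact: yb.
rewrite -addrA gerDl addrC subr_le0.
apply: IH.
- by rewrite (leq_trans _ Cm)// [X in (_ < X)%N](cardsD1 t) tC.
- apply/forall_inP => j /setD1P[_ jC]; apply/forall_inP => k /setD1P[_ kC].
  exact: (forall_inP (forall_inP chC j jC)).
- exact: lower_max_ge0.
- by move=> j /Ct; exact: le_lower_max.
Qed.

(** From [i], descend repeatedly to an element attaining [lower_max], until this maximum is 0. Along
    the resulting chain the transferred coordinates telescope. *)
Lemma chain_sum_transferE y i : exists C : {set 'I_n},
  [/\ is_chain le C, forall j, j \in C -> le j i &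
      \sum_(j in C) (tnth (transfer y) j : R) = tnth y i].
Proof.
have [m] := ubnP (height i); elim: m i => // m IH i; rewrite ltnS => im.
have [max0|[j ji maxj]] := lower_max_attained i y.
  exists [set i]%SET; split => [|j /set1P->//|].
    by apply/forall_inP => j /set1P ->; apply/forall_inP => k /set1P ->; rewrite le_ref.
  by rewrite big_set1 tnth_mktuple max0 subr0.
have [C [chC Cj sumC]] := IH j (leq_trans (height_strict ji) im).
have lij : le j i by move: ji; rewrite in_strict_lower => /andP[].
have Ci k : k \in C -> le k i by move=> /Cj /le_tr; exact.
have iC : i \notin C.
  apply/negP => /Cj leij; have := height_strict ji; rewrite ltnNge => /negP; apply.
  by apply/subset_leq_card/fintype.subsetP => k; rewrite !inE => /le_tr; exact.
exists (i |: C)%SET; split.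
- apply/forall_inP => k /setU1P[->|kC]; apply/forall_inP => l /setU1P[->|lC].
  + by rewrite le_ref.
  + by rewrite (Ci l lC) orbT.
  + by rewrite (Ci k kC).
  + exact: (forall_inP (forall_inP chC k kC)).
- by move=> k /setU1P[->//|]; exact: Ci.
- by rewrite big_setU1//= sumC tnth_mktuple maxj subrK.
Qed.

(** Nonnegativity after transfer amounts to [y] being nonnegative and monotone. Given this, the
    chain inequalities amount to the upper bound 1, by the two preceding lemmas. *)
Lemma preimage_transfer_chain_polytope :
  transfer @^-1` chain_polytope R le = order_polytope.
Proof.
apply/seteqP; split => y /=.
  move=> [z0 z1].
  have my i : lower_max i y <= tnth y i.
    by have := z0 i; rewrite tnth_mktuple subr_ge0.
  split=> [i|i j leij].
    rewrite (le_trans (lower_max_ge0 i y))//=.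
    by have [C [chC _ <-]] := chain_sum_transferE y i; exact: z1.
  have [->//|ij] := eqVneq i j.
  by rewrite (le_trans _ (my j))// le_lower_max// in_strict_lower ij.
move=> [y01 yle]; split => [i|C chC].
  rewrite tnth_mktuple subr_ge0; apply: lower_max_le.
    by have /andP[] := y01 i.
  by move=> j; rewrite in_strict_lower => /andP[_]; exact: yle.
by apply: chain_sum_transfer_le => // i _; have /andP[] := y01 i.
Qed.

Lemma measurable_order_polytope : measurable order_polytope.
Proof.
rewrite -preimage_transfer_chain_polytope -[X in measurable X]setTI.
by apply: transfer_preserving.1 => //; exact: measurable_chain_polytope.
Qed.

End Transfer.

(** * Integrals of the logarithm over ordered simplices *)

Section LogIntegral.
Variable R : realType.
Local Notation mu := (@lebesgue_measure R).

(** For b = a + 1/(n+1), this divided by n+1 is a primitive of x^n (a - ln x). *)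
Let prim n (b x : R) : R := x ^+ n.+1 * (b - ln x).

Lemma is_derive_exprn_ln n (b x : R) : 0 < x ->
  is_derive x 1 (prim n b) (n.+1%:R * x ^+ n * (b - ln x) - x ^+ n).
Proof.
move=> x0; have dl := is_derive1_ln x0.
have dX := is_deriveX n.+1 (is_derive_id (x : R^o) 1).
have dB := is_deriveB (is_derive_cst (b : R^o) (x : R^o) 1) dl.
have := is_deriveM dX dB; rewrite !fctE => /is_derive_eq; apply.
by rewrite /GRing.scale /= exprS; field; rewrite gt_eqF.
Qed.

Lemma integral_exprn_ln_cc n (a e t : R) : 0 < e -> e < t ->
  (\int[mu]_(x in `[e, t]) (x ^+ n * (a - ln x))%:E =
   (n.+1%:R^-1 * prim n (a + n.+1%:R^-1) t)%:E -
   (n.+1%:R^-1 * prim n (a + n.+1%:R^-1) e)%:E)%E.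
Proof.
move=> e0 et; set b := a + _.
have n0 : n.+1%:R != 0 :> R by rewrite pnatr_eq0.
have dF (x : R) : 0 < x -> is_derive x 1 (fun x => n.+1%:R^-1 * prim n b x)
    (x ^+ n * (a - ln x)).
  move=> x0; have := is_derive_exprn_ln n b x0 => dp.
  have -> : (fun x => n.+1%:R^-1 * prim n b x) = n.+1%:R^-1 \*: prim n b by [].
  apply: is_derive_eq; rewrite /GRing.scale /= mulrBr 2!mulrA mulVf// mul1r.
  by rewrite /b; ring.
have cF (x : R) : 0 < x -> {for x, continuous (fun x => n.+1%:R^-1 * prim n b x)}.
  move=> x0; apply: differentiable_continuous; apply/derivable1_diffP.
  by have [] := dF x x0.
apply: (@continuous_FTC2 R (fun x => x ^+ n * (a - ln x))
  (fun x => n.+1%:R^-1 * prim n b x)) => //.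
- apply: derivable_within_continuous => x; rewrite in_itv/= => /andP[ex _].
  have x0 := lt_le_trans e0 ex; have dl := is_derive1_ln x0.
  apply: derivableM; first exact: exprn_derivable.
  by apply: derivableB; [exact: derivable_cst|exact: ex_derive].
- split.
  + move=> x; rewrite in_itv/= => /andP[ex _].
    by have [] := dF x (lt_trans e0 ex).
  + by apply: cvg_at_right_filter; exact: cF.
  + by apply: cvg_at_left_filter; apply: cF; exact: lt_trans et.
- move=> x; rewrite in_itv/= => /andP[ex _].
  by rewrite derive1E; have [] := dF x (lt_trans e0 ex).
Qed.

(** The bounds on [a] and [t] keep the integrand nonnegative on ]0, t], which allows monotone
    convergence. *)
Lemma integral_exprn_ln n (a t : R) : 0 <= a -> 0 <= t <= 1 ->
  (\int[mu]_(x in `[0%R, t]) (x ^+ n * (a - ln x))%:E =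
   (t ^+ n.+1 / n.+1%:R * (a + n.+1%:R^-1 - ln t))%:E)%E.
Proof.
move=> a0 /andP[]; rewrite le_eqVlt => /predU1P[<- _|t0 t1].
  by rewrite set_itv1 integral_set1 expr0n/= !mul0r.
pose F x := n.+1%:R^-1 * prim n (a + n.+1%:R^-1) x.
have mf D : measurable_fun D (fun x : R => (x ^+ n * (a - ln x))%:E).
  apply: measurable_funTS; apply/measurable_EFinP; apply: measurable_funM.
    exact: exprn_measurable.
  by apply: measurable_funB => //; exact: measurable_ln.
(* The integrand may be unbounded at 0: exhaust [0, t] by the intervals [e k, t]. *)
pose e k : R := t / k.+2%:R ^+ 2.
have e0 k : 0 < e k by rewrite divr_gt0// exprn_gt0.
have et k : e k < t by rewrite ltr_pdivrMr ?exprn_gt0// ltr_pMr// exprn_egt1// ltr1n.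
rewrite -integral_itv_obnd_cbnd; last exact: mf.
have -> : `]0, t]%classic = \bigcup_k `[e k, t]%classic.
  apply/seteqP; split => x /=; last first.
    by move=> [k _] /=; rewrite !in_itv/= => /andP[/(lt_le_trans (e0 k))->].
  rewrite in_itv/= => /andP[x0 xt].
  exists (Num.Def.archi_bound (t / x)) => //; rewrite /= in_itv/= xt andbT.
  have tx0 : 0 <= t / x by rewrite divr_ge0// ltW.
  rewrite /e ler_pdivrMr ?exprn_gt0// mulrC -ler_pdivrMr//.
  rewrite (le_trans (ltW (archi_boundP tx0)))//.
  rewrite -natrX ler_nat (leq_trans (leqnSn _))// (leq_trans (leqnSn _))//.
  by rewrite -[leqLHS]expn1 leq_pexp2l.
have f0 (x : R) : 0 < x <= 1 -> 0 <= x ^+ n * (a - ln x).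
  move=> /andP[x0 x1]; rewrite mulr_ge0 ?exprn_ge0 ?(ltW x0)//.
  by rewrite subr_ge0 (le_trans (ln_le0 x1)).
have cvgI := @ge0_nondecreasing_set_cvg_integral _ _ _
  (fun k => `[e k, t]%classic : set (measurableTypeR R))
  (fun x => (x ^+ n * (a - ln x))%:E) mu.
have {}cvgI := cvgI _ (fun k => measurable_itv _) (fun=> mf _).
rewrite -(cvg_lim _ (cvgI _ _))//; last 2 first.
- apply/nondecreasing_seqP => k; apply/subsetPset => x /=; rewrite !in_itv/=.
  move=> /andP[ex ->]; rewrite andbT (le_trans _ ex)//.
  by rewrite /e ler_pM2l// lef_pV2 ?posrE ?exprn_gt0// lerXn2r ?nnegrE// ler_nat.
- move=> k x /=; rewrite in_itv/= => /andP[ex xt]; rewrite lee_fin f0//.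
  by rewrite (lt_le_trans (e0 k) ex) (le_trans xt).
under eq_fun do rewrite integral_exprn_ln_cc//.
apply/cvg_lim => //.
rewrite (_ : (t ^+ n.+1 / _ * _)%:E = (F t)%:E - 0)%E; last first.
  by rewrite sube0 /F /prim; congr EFin; ring.
apply: cvgeB => //; first exact: cvg_cst.
apply: cvg_EFin; first exact: nearW.
pose b := a + n.+1%:R^-1.
have b0 : 0 <= b by rewrite addr_ge0// invr_ge0.
pose B := b - ln t.
have B0 : 0 <= B by rewrite subr_ge0 (le_trans (ln_le0 t1)).
(* Write m = k + 2. Then b - ln (e k) = B + 2 ln m, and ln m <= m with e k = t / m^2 bounds the
   primitive at [e k] by t (B + 2) / m. The square in [e] is there to absorb the logarithm. *)
apply: (@squeeze_cvgr _ _ _ _ (cst 0) ((t * (B + 2)) \*: @harmonic R)).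
- near=> k.
  have ek1 : e k <= 1 by rewrite (le_trans (ltW (et k))).
  have lne : b - ln (e k) = B + ln k.+2%:R *+ 2.
    rewrite /e ln_div ?posrE ?exprn_gt0// lnXn// /B; ring.
  have le0 : 0 <= b - ln (e k) by rewrite subr_ge0 (le_trans (ln_le0 ek1)).
  rewrite /= /cst /= mulr_ge0 ?invr_ge0 ?mulr_ge0 ?exprn_ge0 ?(ltW (e0 k))//=.
  apply: (@le_trans _ _ (prim n b (e k))).
    by rewrite ler_piMl ?mulr_ge0 ?exprn_ge0 ?(ltW (e0 k))// invf_le1// ler1n.
  apply: (@le_trans _ _ (e k * (b - ln (e k)))).
    rewrite ler_wpM2r// exprS ler_piMr ?(ltW (e0 k))//.
    by rewrite exprn_ile1// ltW.
  rewrite lne /e /harmonic /GRing.scale/= -!mulrA ler_pM2l//.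
  have k0 : 0 < k.+2%:R :> R by [].
  apply: (@le_trans _ _ ((B + 2) / k.+2%:R)); last first.
    by rewrite ler_pM2l ?ltr_wpDl// lef_pV2 ?posrE// ler_nat.
  rewrite mulrC ler_pdivrMr ?exprn_gt0//.
  rewrite (_ : (B + 2) / _ * _ = (B + 2) * k.+2%:R); last first.
    by field; rewrite gt_eqF.
  have k1 : 1 <= k.+2%:R :> R by rewrite ler1n.
  have lnk := ltW (ln_sublinear k0).
  have Bk : B <= B * k.+2%:R by rewrite ler_peMr.
  by rewrite mulrDl mulr_natl lerD// lerMn2r.
- exact: cvg_cst.
- rewrite -[X in _ --> X](mulr0 (t * (B + 2))).
  exact: (cvgZl_tmp cvg_harmonic).
Unshelve. all: by end_near. Qed.

End LogIntegral.

(** * Simplices with decreasing coordinates *)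

Section DecreasingSimplex.
Variable R : realType.
Local Notation T := (measurableTypeR R).
Local Notation vol n := (tuple_lebesgue R n).

(** With decreasing coordinates the head is the largest, so fixing it to [s] leaves the same kind of
    simplex with bound [s], in step with the recursive construction of the volume. *)
Definition decreasing_simplex n (t : R) : set (n.-tuple T) :=
  [set y | (forall i, 0 <= (tnth y i : R) <= t) /\
    forall i j : 'I_n, (i <= j)%N -> (tnth y j : R) <= tnth y i].

Lemma measurable_forall_fin d (U : measurableType d) (I : finType)
    (A : I -> set U) :
  (forall i, measurable (A i)) -> measurable [set x | forall i, A i x].
Proof.
move=> mA; rewrite (_ : [set x | _] = \bigcap_(i in [set: I]) A i).
  by apply: fin_bigcap_measurable => //; exact: finite_finset.
by apply/seteqP; split => x /= Ax i; [move=> _|]; exact: Ax.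
Qed.

Lemma measurable_decreasing_simplex n t : measurable (@decreasing_simplex n t).
Proof.
apply: measurableI; apply: measurable_forall_fin => i.
  rewrite -[X in measurable X]setTI.
  have := @measurable_tnth _ T n i.
  move=> /(_ measurableT `[0, t]%classic (measurable_itv _)).
  by rewrite (_ : _ @^-1` _ = [set y | 0 <= (tnth y i : R) <= t]).
apply: measurable_forall_fin => j.
have [ij|ij] := boolP (i <= j)%N; last first.
  by rewrite [X in measurable X](_ : _ = setT)//; apply/seteqP; split=> // y _ /=.
have := @measurable_fun_ler _ (n.-tuple T) R setT (fun y => tnth y j : R)
  (fun y => tnth y i : R) (@measurable_tnth _ _ _ _) (@measurable_tnth _ _ _ _).
move=> /(_ measurableT [set true] Logic.I); rewrite setTI.
by congr measurable; apply/seteqP; split => y /=; [move=> + _|exact].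
Qed.

Lemma decreasing_simplex_cons n (t s : R) (y : n.-tuple T) :
  decreasing_simplex t (tuple_cons (s : T, y)) <->
  0 <= s <= t /\ decreasing_simplex s y.
Proof.
split=> [[yt yd]|[st [ys yd]]].
  split; first by have := yt ord0; rewrite tnth0.
  split=> [i|i j ij].
    have := yd ord0 (lift ord0 i) isT; have := yt (lift ord0 i).
    by rewrite tnth0 !tnthS => /andP[-> _] ->.
  by have := yd (lift ord0 i) (lift ord0 j); rewrite !tnthS; apply.
split=> [i|i j].
  case: (unliftP ord0 i) => [k ->|->]; last by rewrite tnth0.
  have /andP[y0 yst] := ys k; have /andP[_ st'] := st.
  by rewrite tnthS y0 (le_trans yst).
case: (unliftP ord0 i) => [k ->|->]; case: (unliftP ord0 j) => [l ->|->] //.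
- by rewrite !tnthS; exact: yd.
- by move=> _; rewrite tnth0 tnthS; have /andP[] := ys l.
Qed.

(** Tonelli for [f] extended by 0: the slice of the simplex at head [s] is the simplex with bound
    [s], and is empty when [s] is outside [0, t]. *)
Lemma integral_decreasing_simplexS n (t : R) (f : n.+1.-tuple T -> \bar R) :
  measurable_fun setT f -> (forall y, 0 <= f y)%E ->
  (\int[vol n.+1]_(y in decreasing_simplex t) f y =
   \int[@lebesgue_measure R]_(s in `[0%R, t])
     \int[vol n]_(y in decreasing_simplex s) f (tuple_cons (s, y)))%E.
Proof.
move=> mf f0; pose D := @decreasing_simplex n.+1 t.
have mD : measurable D by exact: measurable_decreasing_simplex.
have mfD : measurable_fun setT (f \_ D).
  by apply/(measurable_restrictT f) => //; exact: measurable_funTS.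
have fD0 y : (0 <= (f \_ D) y)%E by apply: erestrict_ge0.
rewrite integral_mkcond.
rewrite [LHS](_ : _ = \int[pushforward (@lebesgue_measure R \x vol n)
    (@tuple_cons R n)]_y (f \_ D) y)%E//.
rewrite (ge0_integral_pushforward (@measurable_tuple_cons R n))//= preimage_setT.
rewrite (fubini_tonelli1 (m1 := @lebesgue_measure R) (m2 := vol n)
  ((f \_ D) \o @tuple_cons R n)); last 2 first.
- by apply: measurableT_comp => //; exact: measurable_tuple_cons.
- by move=> y; exact: fD0.
rewrite [RHS]integral_mkcond; apply: eq_integral => s _.
rewrite /fubini_F patchE; case: ifPn => [|nst].
  rewrite inE /= in_itv/= => st; rewrite [RHS]integral_mkcond.
  apply: eq_integral => y _; rewrite !patchE; congr (if _ then _ else _).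
  apply/idP/idP; rewrite !inE /=; first by move=> /decreasing_simplex_cons[].
  by move=> ys; apply/decreasing_simplex_cons.
apply: integral0_eq => y _; rewrite /= patchE ifN//.
apply: contra nst; rewrite !inE => /decreasing_simplex_cons[st _].
by rewrite /= in_itv.
Qed.

Lemma measurable_ln_tnth n (i : 'I_n) :
  measurable_fun [set: n.-tuple T] (fun y => `|ln (tnth y i : R)|%:E).
Proof.
apply/measurable_EFinP; apply: measurableT_comp => //.
by apply: (measurableT_comp (@measurable_ln R)); exact: measurable_tnth.
Qed.

Lemma volume_decreasing_simplex n (t : R) : 0 <= t ->
  vol n (decreasing_simplex t) = (t ^+ n / n`!%:R)%:E.
Proof.
elim: n t => [|n IH] t t0.
  rewrite /= /dirac indicE mem_set//= ?fact0 ?expr0 ?divr1//.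
  by split=> [[]|[]].
have mD m s : measurable (@decreasing_simplex m s).
  exact: measurable_decreasing_simplex.
transitivity (\int[vol n.+1]_(y in decreasing_simplex t) (cst 1%E) y)%E.
  by rewrite integral_cst; [exact/esym/mul1e|exact: mD].
rewrite (@integral_decreasing_simplexS n t (cst 1%E))//.
transitivity (\int[@lebesgue_measure R]_(s in `[0%R, t])
    (n`!%:R^-1 * s ^+ n)%:E)%E.
  apply: eq_integral => s /[!inE] /=; rewrite in_itv/= => /andP[s0 _].
  rewrite integral_cst; last exact: mD.
  by rewrite [LHS]mul1e mulrC; exact: IH.
move: t0; rewrite le_eqVlt => /predU1P[<-|t0].
  by rewrite set_itv1 integral_set1 expr0n/= mul0r.
have cX m (c x : R) : {for x, continuous (fun x : R => c * x ^+ m)}.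
  by apply: cvgM; [exact: cvg_cst|exact: exprn_continuous].
rewrite (@continuous_FTC2 R _ (fun s => n.+1`!%:R^-1 * s ^+ n.+1))//.
- by rewrite expr0n/= mulr0 sube0 mulrC.
- by apply: continuous_subspaceT => x; exact: cX.
- split=> [x _||].
  + by apply: derivableM; [exact: derivable_cst|exact: exprn_derivable].
  + by apply: cvg_at_right_filter; exact: cX.
  + by apply: cvg_at_left_filter; exact: cX.
- move=> x _; rewrite derive1Ml; last exact: exprn_derivable.
  rewrite exp_derive1 /= factS natrM mulrA; congr (_ * _).
  by rewrite invfM mulrAC mulVf ?mul1r// pnatr_eq0.
Qed.

(* [`|ln x|] stands for [- ln x], with which it agrees on [0, 1]: integrands are
   then nonnegative everywhere. The coordinate [i] is the [(n - i)]-th smallest. *)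
Lemma integral_ln_decreasing_simplex n (i : 'I_n) (t : R) : 0 <= t <= 1 ->
  (\int[vol n]_(y in decreasing_simplex t) `|ln (tnth y i : R)|%:E =
   (t ^+ n / n`!%:R * (\sum_(n - i <= m < n.+1) m%:R^-1 - ln t))%:E)%E.
Proof.
elim: n i t => [[]//|n IH] i t t01.
rewrite integral_decreasing_simplexS//; last exact: measurable_ln_tnth.
have fact_neq0 : n`!%:R != 0 :> R by rewrite pnatr_eq0 -lt0n fact_gt0.
(* In both cases the inner integral is s^n (a - ln s) / n!. If [i] is in the tail, [a] is the
   harmonic sum of the induction hypothesis; if [i] is the head, the logarithm is constant on the
   slice and a = 0. The outer integral then adds 1/(n+1). *)
suff [a a0 [inner ->]] : exists2 a : R, 0 <= a &
    (forall s, 0 <= s <= t -> (\int[vol n]_(y in decreasing_simplex s)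
       `|ln (tnth (tuple_cons (s : T, y)) i : R)|%:E =
       (n`!%:R^-1 * (s ^+ n * (a - ln s)))%:E)%E) /\
    \sum_(n.+1 - i <= m < n.+2) m%:R^-1 = a + n.+1%:R^-1 :> R.
  under eq_integral => s.
    rewrite inE /= in_itv /= => st; rewrite (inner _ st) EFinM; over.
  rewrite ge0_integralZl//; last 2 first.
  - apply: measurable_funTS; apply/measurable_EFinP; apply: measurable_funM.
      exact: exprn_measurable.
    by apply: measurable_funB => //; exact: measurable_ln.
  - move=> s /=; rewrite in_itv/= => /andP[s0 st]; rewrite lee_fin.
    rewrite mulr_ge0 ?exprn_ge0// subr_ge0 (le_trans _ a0)// ln_le0//.
    by rewrite (le_trans st)//; have /andP[] := t01.
  rewrite integral_exprn_ln// -EFinM; congr EFin.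
  rewrite factS natrM; field.
  by rewrite fact_neq0 ?natr1 ?nat1r ?pnatr_eq0.
have /andP[t0 t1] := t01.
case: (unliftP ord0 i) => [j ->|->].
  exists (\sum_(n - j <= m < n.+1) m%:R^-1); first by rewrite sumr_ge0.
  split; last by rewrite /= /bump /= add1n subSS big_nat_recr//= leqW ?leq_subr.
  move=> s /andP[s0 st]; under eq_integral do rewrite tnthS.
  by rewrite IH ?s0 ?(le_trans st)//; congr EFin; rewrite -mulrA mulrCA mulrA.
exists 0 => //; split; last first.
  by rewrite subn0 big_nat1 add0r.
move=> s /andP[s0 st].
transitivity (\int[vol n]_(y in decreasing_simplex s) (cst `|ln s|%:E) y)%E.
  by apply: eq_integral => y _; rewrite tnth0.
rewrite integral_cst; last exact: measurable_decreasing_simplex.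
rewrite [X in (_ * X)%E]volume_decreasing_simplex// -EFinM.
rewrite ler0_norm ?ln_le0 ?(le_trans st)// sub0r.
by congr EFin; rewrite mulrC -mulrA mulrCA mulrA.
Qed.

End DecreasingSimplex.

(** * Spacings *)

Section ChainSpacings.
Variables (R : realType) (n : nat).
Local Notation T := (measurableTypeR R).
Local Notation vol := (tuple_lebesgue R n).
Implicit Types (y z : n.-tuple T).

(** The chain poset: its order polytope is the simplex of increasing tuples, its chain polytope the
    simplex of their spacings. *)
Definition ord_le : rel 'I_n := fun i j => (i <= j)%N.

(* [level y 0 = 0], and [level y m] is the [m]-th coordinate of [y], counted
   from 1. *)
Definition level y (m : nat) : R := nth (0 : R) (0 :: (y : seq R)) m.

Lemma levelS y (i : 'I_n) : level y i.+1 = tnth y i.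
Proof. by rewrite (tnth_nth (0 : R)). Qed.

Lemma le_level y (m k : nat) : order_polytope ord_le y ->
  (m <= k <= n)%N -> level y m <= level y k.
Proof.
move=> [y01 yle]; case: m k => [|m] [|k] // /andP[mk kn].
  by have := y01 (Ordinal kn); rewrite (tnth_nth (0 : R)) => /andP[].
have := yle (Ordinal (leq_trans mk kn)) (Ordinal kn).
by rewrite !(tnth_nth (0 : R)); exact.
Qed.

(* Largest value, in {1, ..., n}, taken by the extension strictly below [i]; it
   is 0 when [i] is minimal. *)
Definition lower_rank (le : rel 'I_n) (s : 'S_n) (i : 'I_n) : nat :=
  \max_(j in strict_lower le i) (s j).+1.

(** Levels increase on this simplex, so the maximum below [i] sits at the largest rank;
    [level y 0 = 0] covers minimal [i]. *)
Lemma lower_max_perm (le : rel 'I_n) (s : 'S_n) i y :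
  order_polytope ord_le y ->
  lower_max le i (tuple_perm s y) = level y (lower_rank le s i).
Proof.
move=> Ky; have rank_le_n : (lower_rank le s i <= n)%N.
  by apply/bigmax_leqP => j _.
apply/le_anti/andP; split.
  apply: lower_max_le => [|j ji]; first by rewrite (@le_level _ 0).
  rewrite tnth_mktuple -levelS le_level// rank_le_n andbT.
  exact: (leq_bigmax_cond (F := fun j => (s j).+1)).
rewrite /lower_rank; case: (posnP #|strict_lower le i|) => [c0|].
  rewrite big_pred0 ?lower_max_ge0// => j; exact: (card0_eq c0).
move=> /(eq_bigmax_cond (fun j => (s j).+1))[j ji ->].
by rewrite levelS -[leLHS](tnth_mktuple (fun i => tnth y (s i))) le_lower_max.
Qed.

(** The right-hand side is a block of consecutive spacings, whose number is d_i(sigma) by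
    [poset_gap_ext_val] below. *)
Lemma transfer_permE (le : rel 'I_n) (s : 'S_n) i y :
  order_polytope ord_le y ->
  tnth (transfer le (tuple_perm s y)) i =
  level y (s i).+1 - level y (lower_rank le s i).
Proof. by move=> Ky; rewrite !tnth_mktuple lower_max_perm// levelS. Qed.

Lemma transfer_chainE i y : order_polytope ord_le y ->
  tnth (transfer ord_le y) i = level y i.+1 - level y i.
Proof.
move=> Ky; have y1 : tuple_perm 1%g y = y.
  by apply: eq_from_tnth => j; rewrite tnth_mktuple perm1.
rewrite -{1}y1 transfer_permE// perm1; congr (_ - level y _).
apply/eqP; rewrite eqn_leq; apply/andP; split.
  apply/bigmax_leqP => j; rewrite in_strict_lower perm1 /ord_le.
  by rewrite ltn_neqAle.
case: i => -[//|i] /= iS; have i_n := ltnW iS.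
rewrite /lower_rank (bigop.bigmax_sup (Ordinal i_n))// ?perm1//.
by rewrite in_strict_lower /ord_le /= -val_eqE/= ltn_eqF/=.
Qed.

Lemma sum_transfer_chain (a b : nat) y : order_polytope ord_le y ->
  (a <= b <= n)%N ->
  \sum_(j < n | (a <= j < b)%N) (tnth (transfer ord_le y) j : R) =
  level y b - level y a.
Proof.
move=> Ky /andP[ab bn]; elim: b ab bn => [|b IH].
  by rewrite leqn0 => /eqP-> _; rewrite big_pred0 ?subrr// => j; rewrite ltn0 andbF.
rewrite leq_eqVlt => /predU1P[-> _|].
  rewrite big_pred0 ?subrr// => j; apply/negbTE/negP => /andP[+ jb].
  by rewrite leqNgt jb.
rewrite ltnS => ab bn; rewrite (bigD1 (Ordinal bn))/= ?ab ?ltnSn//.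
rewrite transfer_chainE// (eq_bigl (fun j : 'I_n => (a <= j < b)%N)).
  by rewrite (IH ab (ltnW bn)) addrA subrK.
by move=> j; rewrite -val_eqE/=; lia.
Qed.

(** Every subset is a chain here, and by nonnegativity the full sum dominates. This description is
    symmetric in the coordinates, which gives the exchangeability of spacings. *)
Lemma chain_polytope_ordP z : chain_polytope R ord_le z <->
  (forall i, 0 <= (tnth z i : R)) /\ \sum_(i < n) (tnth z i : R) <= 1.
Proof.
split=> -[z0 z1]; split=> //.
  rewrite (_ : \sum_(i < n) _ = \sum_(i in [set: 'I_n]%SET) (tnth z i : R)).
    apply: z1; apply/forall_inP => i _; apply/forall_inP => j _.
    exact: leq_total.
  by apply: eq_bigl => i; rewrite inE.
move=> C _; apply: le_trans z1; rewrite big_mkcond; apply: ler_sum => i _.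
by case: ifP.
Qed.

Lemma chain_polytope_ord_perm (s : 'S_n) :
  tuple_perm s @^-1` chain_polytope R ord_le = chain_polytope R ord_le.
Proof.
have sumE z : \sum_(i < n) (tnth (tuple_perm s z) i : R) = \sum_(i < n) tnth z i.
  rewrite [RHS](reindex_inj (@perm_inj _ s)).
  by apply: eq_bigr => i _; rewrite tnth_mktuple.
apply/seteqP; split => z /= /chain_polytope_ordP[z0 z1];
  apply/chain_polytope_ordP; split; move: z1; rewrite ?sumE// => _ i.
  by have := z0 ((s^-1)%g i); rewrite tnth_mktuple permKV.
by rewrite tnth_mktuple.
Qed.

(* Cyclic rotation of the indices by [a], sending [a, b) onto [0, b - a). *)
Definition rotate (a : nat) (i : 'I_n) : nat :=
  if (a <= i)%N then (i - a)%N else (i + (n - a))%N.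

Lemma rotate_lt a i : (a <= n)%N -> (rotate a i < n)%N.
Proof. by move: (ltn_ord i); rewrite /rotate; case: ifP; lia. Qed.

Lemma exists_rotation a : (a <= n)%N ->
  exists s : 'S_n, forall i, s i = rotate a i :> nat.
Proof.
move=> an; pose f i := Ordinal (rotate_lt i an).
have finj : injective f.
  move=> i j /(congr1 val) /= ij; apply/val_inj => /=; move: ij.
  by move: (ltn_ord i) (ltn_ord j); rewrite /rotate; do 2 case: ifP; lia.
by exists (perm finj) => i; rewrite permE.
Qed.

Lemma measurable_ln_sum (P : pred 'I_n) :
  measurable_fun [set: n.-tuple T]
    (fun z => `|ln (\sum_(j < n | P j) (tnth z j : R))|%:E).
Proof.
apply/measurable_EFinP; apply: measurableT_comp => //.
apply: (measurableT_comp (@measurable_ln R)).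
rewrite (_ : (fun _ => _) = fun z : n.-tuple T =>
    \sum_(j < n) (if P j then tnth z j : R else 0)); last first.
  by apply/funext => z; rewrite big_mkcond.
apply: (@measurable_sum _ _ R _ _ _
  (fun j (z : n.-tuple T) => if P j then tnth z j : R else 0)) => j.
by case: (P j) => //; exact: measurable_tnth.
Qed.

Let ord_le_refl : reflexive ord_le. Proof. by move=> i; exact: leqnn. Qed.
Let ord_le_anti : antisymmetric ord_le.
Proof. by move=> i j /anti_leq /val_inj. Qed.
Let ord_le_trans : transitive ord_le.
Proof. by move=> i j k; exact: leq_trans. Qed.

Let transferP :=
  @transfer_preserving R n ord_le ord_le_refl ord_le_anti ord_le_trans.

Lemma integral_ln_spacing_sum (a b : nat) : (a <= b <= n)%N ->
  (\int[vol]_(z in chain_polytope R ord_le)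
      `|ln (\sum_(j < n | (a <= j < b)%N) (tnth z j : R))|%:E =
   \int[vol]_(y in order_polytope ord_le)
      `|ln (level y b - level y a)|%:E)%E.
Proof.
move=> abn; rewrite (integral_preserving transferP)//; last 2 first.
- exact: measurable_chain_polytope.
- by apply: measurable_funTS; exact: measurable_ln_sum.
rewrite preimage_transfer_chain_polytope//.
by apply: eq_integral => y /[!inE] Ky; rewrite sum_transfer_chain.
Qed.

Lemma tuple_perm_rev_order_polytope :
  tuple_perm (perm (@rev_ord_inj n)) @^-1` order_polytope ord_le =
  @decreasing_simplex R n 1.
Proof.
apply/seteqP; split=> y /= [y01 yle]; split=> [i|i j ij].
- by have := y01 (rev_ord i); rewrite tnth_mktuple permE rev_ordK.
- have := yle (rev_ord j) (rev_ord i); rewrite !tnth_mktuple !permE !rev_ordK.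
  by apply; rewrite /ord_le /= leq_sub2l.
- by rewrite tnth_mktuple.
- by rewrite !tnth_mktuple !permE; apply: yle; rewrite /= leq_sub2l.
Qed.

Lemma measurable_ord_polytope : measurable (@order_polytope R n ord_le).
Proof. exact: measurable_order_polytope. Qed.

Lemma volume_ord_polytope : vol (order_polytope ord_le) = (n`!%:R^-1)%:E.
Proof.
have [_ <-//] := @tuple_perm_preserving R n (perm (@rev_ord_inj n)).
  rewrite tuple_perm_rev_order_polytope volume_decreasing_simplex//.
  by rewrite expr1n mul1r.
exact: measurable_ord_polytope.
Qed.

(** Pass to spacings, rotate the block [a, b) to the front by exchangeability, and pass back: the
    difference of levels becomes a single coordinate, handled by reversal and
    [integral_ln_decreasing_simplex]. *)
Lemma integral_ln_spacing (a b : nat) : (a < b <= n)%N ->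
  (\int[vol]_(y in order_polytope ord_le) `|ln (level y b - level y a)|%:E =
   (n`!%:R^-1 *
      (harmonic_number R n - harmonic_number R (b - a).-1))%:E)%E.
Proof.
move=> /andP[ab bn]; have an : (a <= n)%N := ltnW (leq_trans ab bn).
rewrite -integral_ln_spacing_sum ?(ltnW ab)//.
have [s sE] := exists_rotation an.
rewrite -(chain_polytope_ord_perm s).
transitivity (\int[vol]_(z in chain_polytope R ord_le)
    `|ln (\sum_(j < n | (0 <= j < b - a)%N) (tnth z j : R))|%:E)%E.
  (* The rotation sends exactly the indices in [a, b) below [b - a]; an index smaller than [a] lands
     at [n - a] or beyond. *)
  rewrite [RHS](integral_preserving (tuple_perm_preserving R s^-1%g))//; last 2 first.
  - exact: measurable_chain_polytope.
  - by apply: measurable_funTS; exact: measurable_ln_sum.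
  rewrite !chain_polytope_ord_perm; apply: eq_integral => z _.
  congr (`|ln _|%:E); rewrite [RHS](reindex_inj (@perm_inj _ s))/=.
  apply: eq_big => [j|j _]; last by rewrite tnth_mktuple permK.
  by rewrite sE /rotate; move: (ltn_ord j); case: ifP; lia.
rewrite integral_ln_spacing_sum; last by lia.
(* As [level y 0 = 0], the first [b - a] spacings add up to the coordinate number [b - a], which has
   index [(b - a).-1] counted from 0. *)
have cn : ((b - a).-1 < n)%N by lia.
pose c := Ordinal cn.
transitivity (\int[vol]_(y in order_polytope ord_le) `|ln (tnth y c : R)|%:E)%E.
  apply: eq_integral => y _; rewrite -levelS /= subr0; congr (`|ln (level y _)|%:E).
  by rewrite prednK// subn_gt0.
rewrite (integral_preserving (tuple_perm_preserving R (perm (@rev_ord_inj n))))//.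
- rewrite tuple_perm_rev_order_polytope.
  under eq_integral do rewrite tnth_mktuple permE.
  rewrite integral_ln_decreasing_simplex ?ler01 ?lexx// expr1n mul1r ln1 subr0.
  congr (_ * _)%:E; rewrite /harmonic_number.
  (* The reversed index of [c] is [n - (b - a)], so the harmonic sum starts at m = b - a. *)
  rewrite [X in _ = X - _](@big_cat_nat _ _ _ (b - a).-1.+1)//=; last by lia.
  rewrite addrAC subrr add0r; congr bigop.
  by rewrite /= subKn//; lia.
- exact: measurable_ord_polytope.
- by apply: measurable_funTS; exact: measurable_ln_tnth.
Qed.

End ChainSpacings.

(** * Decomposition of the order polytope *)

Section Decomposition.
Variables (R : realType) (n : nat) (le : rel 'I_n).
Hypotheses (le_ref : reflexive le) (le_asym : antisymmetric le)
  (le_tr : transitive le).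
Local Notation T := (measurableTypeR R).
Local Notation vol := (tuple_lebesgue R n).
Local Notation K := (@order_polytope R n (@ord_le n)).
Implicit Types (y z : n.-tuple T) (s : 'S_n).

Definition sorted_by s : set (n.-tuple T) := tuple_perm s^-1%g @^-1` K.

Lemma sorted_byP s y : sorted_by s y <->
  (forall i, 0 <= (tnth y i : R) <= 1) /\
  forall i j, (s i <= s j)%N -> (tnth y i : R) <= tnth y j.
Proof.
split=> -[y01 yle]; split=> [i|i j ij].
- by have := y01 (s i); rewrite tnth_mktuple permK.
- by have := yle (s i) (s j) ij; rewrite !tnth_mktuple !permK.
- by rewrite tnth_mktuple.
- by rewrite !tnth_mktuple; apply: yle; rewrite !permKV.
Qed.

Lemma tuple_perm_sorted_by s : tuple_perm s @^-1` sorted_by s = K.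
Proof.
rewrite /sorted_by -comp_preimage (_ : _ \o _ = id)//.
by apply/funext => y; apply: eq_from_tnth => i; rewrite /= !tnth_mktuple permKV.
Qed.

Lemma measurable_sorted_by s : measurable (sorted_by s).
Proof.
rewrite -[X in measurable X]setTI.
by apply: (tuple_perm_preserving R s^-1%g).1 => //; exact: measurable_ord_polytope.
Qed.

Lemma ae_distinct_coords :
  {ae vol, forall y, injective (fun i => tnth y i : R)}.
Proof.
have ties (i j : 'I_n) : {ae vol, forall y : n.-tuple T,
    (tnth y i : R) = tnth y j -> i = j}.
  have [->|ij] := eqVneq i j; first exact: aeW.
  exists [set y | (tnth y i : R) = tnth y j]; split.
  - rewrite -[X in measurable X]setTI.
    have := @measurable_fun_eqr _ (n.-tuple T) R setT (fun y => tnth y i : R)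
      (fun y => tnth y j : R) (@measurable_tnth _ _ _ _) (@measurable_tnth _ _ _ _).
    move=> /(_ measurableT [set true] Logic.I).
    by congr measurable; apply/seteqP; split => y /= [_ /eqP].
  - exact: tuple_lebesgue_eq_coord.
  - by move=> y /=; apply: contra_notP => yij /yij.
have : {ae vol, forall y : n.-tuple T, forall i j : 'I_n,
    (tnth y i : R) = tnth y j -> i = j}.
  by apply: filter_forall => i; apply: filter_forall => j; exact: ties.
by apply: filterS => y yinj i j; exact: yinj.
Qed.

(** When [y] in the unit cube has distinct coordinates, this is the unique permutation that sorts
    it. *)
Definition coord_rank y (i : 'I_n) : nat := #|[set j | (tnth y j : R) < tnth y i]%SET|.

Lemma coord_rank_lt y i : (coord_rank y i < n)%N.
Proof.
rewrite -[ltnRHS]card_ord; apply/proper_card/properP; split.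
  by apply/fintype.subsetP.
by exists i => //; rewrite inE ltxx.
Qed.

Lemma ltn_coord_rank y i j : (tnth y i : R) < tnth y j ->
  (coord_rank y i < coord_rank y j)%N.
Proof.
move=> ij; apply/proper_card/properP; split.
  by apply/fintype.subsetP => k; rewrite !inE => /lt_trans; exact.
by exists i; rewrite inE ?ltxx.
Qed.

Lemma coord_rank_inj y : injective (fun i => tnth y i : R) ->
  injective (coord_rank y).
Proof.
move=> yinj i j rij; apply: yinj; apply/eqP; rewrite eq_le !leNgt.
by apply/andP; split; apply/negP => /ltn_coord_rank; rewrite rij ltnn.
Qed.

Lemma sorted_by_rank s y : injective (fun i => tnth y i : R) ->
  sorted_by s y -> forall i, s i = coord_rank y i :> nat.
Proof.
move=> yinj /sorted_byP[_ ys] i.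
have lt_iff j : (tnth y j : R) < tnth y i = (s j < s i)%N.
  apply/idP/idP => [|ji]; first by apply: contraTT; rewrite -leqNgt -leNgt; exact: ys.
  rewrite lt_neqAle ys 1?ltnW// andbT; apply: contraTneq ji => /yinj ->.
  by rewrite ltnn.
rewrite /coord_rank -sum1dep_card (eq_bigl (fun j => s j < s i)%N)//.
rewrite -(reindex_inj (P := fun k : 'I_n => (k < s i)%N) (F := fun=> 1%N)
  (@perm_inj _ s)).
by rewrite -(big_ord_widen n (fun=> 1%N)) ?sum1_card ?card_ord// ltnW.
Qed.

(** The rank permutation is a linear extension: if i lies below j, every coordinate smaller than
    that of i is smaller than that of j. *)
Lemma exists_sorted_by y : injective (fun i => tnth y i : R) ->
  order_polytope le y ->
  exists2 s, s \in linear_extensions le & sorted_by s y.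
Proof.
move=> yinj [y01 yle].
have rinj : injective (fun i => Ordinal (coord_rank_lt y i)).
  by move=> i j /(congr1 val); exact: coord_rank_inj.
exists (perm rinj).
  rewrite inE; apply/forallP => i; apply/forallP => j; apply/implyP => ij.
  rewrite !permE /=; apply/subset_leq_card/fintype.subsetP => k; rewrite !inE.
  by move=> /lt_le_trans; apply; exact: yle.
apply/sorted_byP; split=> // i j; rewrite !permE /=.
by apply: contraTT; rewrite -ltNge -ltnNge; exact: ltn_coord_rank.
Qed.

Lemma sorted_by_order_polytope s y : s \in linear_extensions le ->
  sorted_by s y -> order_polytope le y.
Proof.
rewrite inE => /forallP sL /sorted_byP[y01 ys]; split=> // i j ij.
by apply: ys; move/forallP: (sL i) => /(_ j)/implyP; exact.
Qed.

Lemma restrict_order_polytope (G : n.-tuple T -> \bar R) y :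
  injective (fun i => tnth y i : R) ->
  ((G \_ (order_polytope le)) y =
   \sum_(s in linear_extensions le) (G \_ (sorted_by s)) y)%E.
Proof.
move=> yinj; rewrite patchE; case: ifPn => [|/negP]; rewrite inE => Oy.
  have [s sL ys] := exists_sorted_by yinj Oy.
  rewrite (bigD1 s)//= patchE mem_set// big1 ?adde0// => s' /andP[_ s's].
  rewrite patchE ifN//; apply: contra s's; rewrite inE => ys'.
  apply/eqP/permP => i; apply/val_inj => /=.
  by rewrite (sorted_by_rank yinj ys') (sorted_by_rank yinj ys).
rewrite big1// => s sL; rewrite patchE ifN//; apply/negP; rewrite inE.
by move=> /(sorted_by_order_polytope sL).
Qed.

(** Off the null set of ties, exactly one piece [sorted_by s] contains a given point of the order
    polytope. Each piece is then pulled back to the simplex by [tuple_perm s]. *)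
Lemma integral_order_polytope (G : n.-tuple T -> \bar R) :
  measurable_fun setT G -> (forall y, 0 <= G y)%E ->
  (\int[vol]_(y in order_polytope le) G y =
   \sum_(s in linear_extensions le) \int[vol]_(y in K) G (tuple_perm s y))%E.
Proof.
move=> mG G0.
have mGD (D : set (n.-tuple T)) : measurable D -> measurable_fun setT (G \_ D).
  by move=> mD; apply/(measurable_restrictT G) => //; exact: measurable_funTS.
have GD0 (D : set (n.-tuple T)) y : (0 <= (G \_ D) y)%E by apply: erestrict_ge0.
rewrite integral_mkcond.
transitivity (\int[vol]_y
    \sum_(s <- enum (linear_extensions le)) (G \_ (sorted_by s)) y)%E.
  apply: ge0_ae_eq_integral => //.
  - by apply: mGD; exact: measurable_order_polytope.
  - by apply: emeasurable_sum => s; apply: mGD; exact: measurable_sorted_by.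
  - by move=> y _; exact: sume_ge0.
  - apply: filterS ae_distinct_coords => y yinj _.
    by rewrite big_enum; exact: restrict_order_polytope.
rewrite ge0_integral_sum//; last first.
  by move=> s; apply: mGD; exact: measurable_sorted_by.
rewrite big_enum; apply: eq_bigr => s _; rewrite -integral_mkcond.
rewrite [LHS](integral_preserving (tuple_perm_preserving R s))//.
- by rewrite tuple_perm_sorted_by.
- exact: measurable_sorted_by.
- exact: measurable_funTS.
Qed.

Lemma integral_chain_polytope (F : n.-tuple T -> \bar R) :
  measurable_fun setT F -> (forall z, 0 <= F z)%E ->
  (\int[vol]_(z in chain_polytope R le) F z =
   \sum_(s in linear_extensions le)
     \int[vol]_(y in K) F (transfer le (tuple_perm s y)))%E.
Proof.
move=> mF F0; have tp := @transfer_preserving R n le le_ref le_asym le_tr.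
rewrite (integral_preserving tp)//; last 2 first.
- exact: measurable_chain_polytope.
- exact: measurable_funTS.
rewrite preimage_transfer_chain_polytope//.
apply: (@integral_order_polytope (F \o transfer le)).
  by apply: measurableT_comp => //; exact: tp.1.
by move=> y; exact: F0.
Qed.

(** Since [s i] counts from 0 and [lower_rank] from 1, this says that the gap is at least 1. *)
Lemma lower_rank_le s i : s \in linear_extensions le ->
  (lower_rank le s i <= s i)%N.
Proof.
rewrite inE => /forallP sL; apply/bigmax_leqP => j.
rewrite in_strict_lower => /andP[ji leji].
rewrite ltn_neqAle (inj_eq val_inj) (inj_eq perm_inj) ji /=.
by move/forallP: (sL j) => /(_ i)/implyP; exact.
Qed.

(** The least difference is the difference with the largest value below [i]; for minimal [i] the
    rank 0 returns the value itself. *)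
Lemma poset_gap_ext_val s i : poset_gap le (ext_val s) i =
  (s i).+1%:Z - (lower_rank le s i)%:Z.
Proof.
rewrite /poset_gap; case: pickP => [j0 j0i|no]; last first.
  by rewrite /lower_rank big_pred0 ?subr0.
have c0 : (0 < #|strict_lower le i|)%N by apply/card_gt0P; exists j0.
apply/le_anti/andP; split.
  rewrite /lower_rank.
  have [j ji ->] := eq_bigmax_cond (fun j => (s j).+1) c0.
  by rewrite -[leRHS]/(ext_val s i - ext_val s j); exact: bigmin_le_cond.
by apply: le_bigmin => [|j ji]; rewrite lerB// lez_nat;
  exact: (leq_bigmax_cond (F := fun j => (s j).+1)).
Qed.

(** Each linear extension contributes one simplex of volume 1/n!. *)
Lemma volume_chain_polytope :
  vol (chain_polytope R le) = (#|linear_extensions le|%:R / n`!%:R)%:E.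
Proof.
have mC : measurable (chain_polytope R le) by exact: measurable_chain_polytope.
transitivity (\int[vol]_(z in chain_polytope R le) (cst 1%E) z)%E.
  by rewrite integral_cst; [exact/esym/mul1e|exact: mC].
rewrite (@integral_chain_polytope (cst 1%E))//.
transitivity (\sum_(s in linear_extensions le) (n`!%:R^-1 : R)%:E)%E.
  apply: eq_bigr => s _; rewrite integral_cst; last exact: measurable_ord_polytope.
  by rewrite [LHS]mul1e; exact: volume_ord_polytope.
by rewrite sumEFin sumr_const mulr_natl.
Qed.

Lemma integral_ln_chain_polytope i :
  (\int[vol]_(z in chain_polytope R le) `|ln (tnth z i : R)|%:E =
   (\sum_(s in linear_extensions le) n`!%:R^-1 *
      (harmonic_number R n -
       harmonic_number R `|poset_gap le (ext_val s) i - 1|%N))%:E)%E.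
Proof.
have mi := @measurable_ln_tnth R n i.
rewrite (integral_chain_polytope mi); last first.
  by move=> z; rewrite lee_fin normr_ge0.
rewrite -sumEFin; apply: eq_bigr => s sL; have si := lower_rank_le i sL.
transitivity (\int[vol]_(y in K)
    `|ln (level y (s i).+1 - level y (lower_rank le s i))|%:E)%E.
  by apply: eq_integral => y /[!inE] Ky; rewrite transfer_permE.
rewrite integral_ln_spacing ?ltnS ?si//=; congr (_ * (_ - harmonic_number R _))%:E.
by rewrite poset_gap_ext_val; lia.
Qed.

End Decomposition.

Theorem theorem9 (R : realType) (n : nat) (le : rel 'I_n)
    (le_refl : reflexive le) (le_anti : antisymmetric le)
    (le_trans : transitive le) :
  (QLB R le)%:E = (n%:R%:E * ((harmonic_number R n)%:E - QH R le))%E.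
Proof.
(* For n = 0 the sums over coordinates are empty, and the right-hand side is 0 because of its factor
   n. *)
have [n0|n0] := posnP n.
  rewrite [X in X%:R%:E]n0 mul0e /QLB big1 ?mul0r// => s _; apply: big1 => i _.
  by have := ltn_ord i; rewrite [X in (_ < X)%N]n0.
pose vol := tuple_lebesgue R n; pose C := chain_polytope R le.
pose L := linear_extensions le; pose V : R := #|L|%:R / n`!%:R.
have mC : measurable C by exact: measurable_chain_polytope.
have volC : vol C = V%:E by exact: volume_chain_polytope.
have V0 : 0 < V by rewrite -lte_fin -volC chain_polytope_volume_gt0.
have PE A : uniform_chain_polytope R le A = (vol (A `&` C) * V^-1%:E)%E.
  by rewrite uniform_chain_polytopeE// -/vol -/C volC.
have PCc : uniform_chain_polytope R le (~` C) = 0%E.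
  by rewrite PE setICl measure0 mul0e.
have mcoord (i : 'I_n) := @measurable_ln_tnth R n i.
have n1 : 0 <= n%:R^-1 :> R by rewrite invr_ge0.
pose X (z : n.-tuple (measurableTypeR R)) : \bar R :=
  ((n%:R^-1)%:E * \sum_(i < n) `|ln (tnth z i : R)|%:E)%E.
have mX : measurable_fun setT X.
  by apply: emeasurable_funM => //; exact: emeasurable_sum.
have X0 z : (0 <= X z)%E.
  by rewrite mule_ge0 ?lee_fin//; apply: sume_ge0 => i _; rewrite lee_fin.
(* The chain polytope lies in the unit cube, by its singleton chains, so -ln and |ln| agree on it;
   its complement has probability 0. *)
have -> : QH R le = (\int[uniform_chain_polytope R le]_z X z)%E.
  rewrite /QH unlock; apply: ae_eq_integral => //.
    apply/measurable_EFinP; apply: measurable_funM => //.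
    apply: (@measurable_sum _ _ R _ _ _ (fun i z => ln (tnth z i : R))) => i.
    by apply: (measurableT_comp (@measurable_ln R)); exact: measurable_tnth.
  exists (~` C); split=> //; first exact: measurableC.
  move=> z /=; apply: contra_not => -[z0 z1] _.
  rewrite /X sumEFin -EFinM mulNr -mulrN -sumrN; congr (_ * _)%:E.
  apply: eq_bigr => i _; rewrite ler0_norm// ln_le0//.
  have := z1 [set i]%SET; rewrite big_set1; apply.
  by apply/forall_inP => j /set1P ->; apply/forall_inP => k /set1P ->; rewrite le_refl.
rewrite (ge0_negligible_integral _ _ _ _ PCc)//; last exact: measurableC.
rewrite setTD setCK.
have Vi0 : 0 <= V^-1 by rewrite invr_ge0 ltW.
(* Inside the polytope the uniform law is the volume scaled by 1/V. *)
rewrite (@eq_measure_integral _ _ _ _ (mscale (NngNum Vi0) vol)); last first.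
  move=> A mA AC; rewrite /= PE /mscale /= muleC; congr (_ * vol _)%E.
  by apply/setIidPl.
rewrite ge0_integral_mscale//; last exact: measurable_funTS.
rewrite ge0_integralZl//; last 2 first.
- by apply: measurable_funTS; exact: emeasurable_sum.
- by move=> z _; exact: sume_ge0.
rewrite ge0_integral_sum//; last by move=> i; exact: measurable_funTS.
under eq_bigr do rewrite integral_ln_chain_polytope//.
rewrite sumEFin -!EFinM; congr EFin.
have L0 : #|L|%:R != 0 :> R.
  by apply: contraTneq V0 => L0; rewrite /V L0 mul0r ltxx.
have fact0 : n`!%:R != 0 :> R by rewrite pnatr_eq0 -lt0n fact_gt0.
have n0' : n%:R != 0 :> R by rewrite pnatr_eq0 -lt0n.
(* Only finite sums remain. The factor 1/n! of each integral cancels against the one in [V], and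
   H_n, met once per pair of an extension and a coordinate, separates from the sum in [QLB]. *)
rewrite exchange_big/=.
under eq_bigr do rewrite -mulr_sumr sumrB sumr_const card_ord.
rewrite -mulr_sumr sumrB sumr_const -[harmonic_number R n *+ n]mulr_natl.
rewrite -[_ * harmonic_number R n *+ #|L|]mulr_natl /QLB /V -/L.
by field; rewrite n0' fact0 L0.
Qed.
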